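(* Let $H$ be a Hilbert space, let $A,B:H\rightrightarrows H$ be maximally monotone operators with $\mathrm{zer}(A+B)\neq\emptyset$, and let $\gamma>0$. Let $x_0,u\in H$, let $(\lambda_n)$ be a sequence in $[0,2]$ and $(\beta_n)$ a sequence in $[0,1]$, and let the Tikhonov-Douglas-Rachford algorithm be defined by $$u_n=(1-\beta_n)u+\beta_nx_n,\quad y_n=J_{\gamma B}u_n,\quad z_n=J_{\gamma A}(2y_n-u_n),\quad x_{n+1}=u_n+\lambda_n(z_n-y_n).$$ Let $T=R_{\gamma A}R_{\gamma B}:H\to H$. Then $T$ is nonexpansive, $Fix(T)\neq\emptyset$, and for all $n\in\mathbb N$, $$x_{n+1}=\left(1-\frac{\lambda_n}2\right)u_n+\frac{\lambda_n}2Tu_n.$$ That is, $(x_n)$ is the Tikhonov-Mann iteration associated with $T$, with parameters $(\beta_n)$ and $\left(\frac{\lambda_n}2\right)$.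
   Context: For a set-valued operator $A:H\rightrightarrows H$, $\mathrm{zer}A=\{x\in H\mid 0\in Ax\}$; $A$ is monotone if $\langle x-y,v-w\rangle\ge0$ for all $x,y\in H$, $v\in Ax$, $w\in Ay$; it is maximally monotone if it is monotone and its graph is not properly contained in the graph of another monotone operator. The resolvent is $J_A=(\mathrm{Id}+A)^{-1}$ and the reflected resolvent is $R_A=2J_A-\mathrm{Id}$; for maximally monotone $A$ these are single-valued mappings $H\to H$. $T:H\to H$ is nonexpansive if $\|Tx-Ty\|\le\|x-y\|$ for all $x,y$; $Fix(T)$ is its set of fixed points. The Tikhonov-Mann iteration (in a Hilbert space $H$) associated with a nonexpansive mapping $T:H\to H$ having a fixed point, points $x_0,u\in H$ and parameter sequences $(\beta_n),(\mu_n)$ in $[0,1]$ is $x_{n+1}=(1-\mu_n)u_n+\mu_nTu_n$ with $u_n=(1-\beta_n)u+\beta_nx_n$. *)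

(* Defs.v *)
From HB Require Import structures.
From mathcomp Require Import all_boot all_order all_algebra.
From mathcomp Require Import all_classical all_reals all_analysis.

Set Implicit Arguments.
Unset Strict Implicit.
Unset Printing Implicit Defensive.

Import Order.TTheory GRing.Theory Num.Theory.
Import numFieldNormedType.Exports.

Local Open Scope classical_set_scope.
Local Open Scope ring_scope.

(* Real Hilbert spaces: complete normed spaces whose norm is induced by a
   symmetric, positive definite bilinear form. *)
HB.mixin Record isHilbert (R : realType) H & CompleteNormedModule R H := {
  inner : {dot H for @idfun R} ;
  norm_inner : forall x : H, `|x| ^+ 2 = inner x x
}.

#[short(type="hilbertType")]
HB.structure Definition Hilbert (R : realType) :=
  { H of CompleteNormedModule R H & isHilbert R H }.

Section SetValuedOperators.
Context {R : realType} {H : hilbertType R}.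
Implicit Types (A B : H -> set H) (x y u v w : H) (g : R).

Definition graph A : set (H * H) := [set p | A p.1 p.2].

Definition zer A : set H := [set x | A x 0].

Definition op_id : H -> set H := fun x => [set x].

Definition op_add A B : H -> set H :=
  fun x => [set w | exists v1 v2, [/\ A x v1, B x v2 & w = v1 + v2]].

Definition op_scale g A : H -> set H := fun x => [set g *: v | v in A x].

Definition op_inv A : H -> set H := fun v => [set x | A x v].

Definition monotone A : Prop :=
  forall x y v w, A x v -> A y w -> 0 <= inner (x - y) (v - w).

Definition maximally_monotone A : Prop :=
  monotone A /\ ~ exists B, monotone B /\ graph A `<` graph B.

Definition set_resolvent A : H -> set H := op_inv (op_add op_id A).

(* J_A as a mapping H -> H: [resolvent A x] is the unique element of
   [set_resolvent A x] when [A] is maximally monotone; [xget] takes the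
   default value 0 only where [set_resolvent A x] is empty. *)
Definition resolvent A : H -> H := fun x => xget 0 (set_resolvent A x).

Definition reflected_resolvent A : H -> H := fun x => 2 *: resolvent A x - x.

End SetValuedOperators.

Section FixedPointIterations.
Context {R : realType} {H : hilbertType R}.
Implicit Types (T : H -> H).

Definition nonexpansive T : Prop := forall x y, `|T x - T y| <= `|x - y|.

Definition Fix T : set H := [set x | T x = x].

Definition is_tikhonov_mann T (x0 u : H) (beta mu : nat -> R)
    (x : nat -> H) : Prop :=
  [/\ nonexpansive T /\ Fix T !=set0,
      forall n, 0 <= beta n <= 1,
      forall n, 0 <= mu n <= 1,
      x 0%N = x0 &
      forall n, let un := (1 - beta n) *: u + beta n *: x n in
        x n.+1 = (1 - mu n) *: un + mu n *: T un].

End FixedPointIterations.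

(* Main.v *)
Require Import Defs.
From mathcomp Require Import all_boot all_order all_algebra.
From mathcomp Require Import all_classical all_reals all_analysis.
From mathcomp Require Import ring lra.

Set Implicit Arguments.
Unset Strict Implicit.
Unset Printing Implicit Defensive.

Import Order.TTheory GRing.Theory Num.Theory.
Import numFieldNormedType.Exports.
Local Open Scope classical_set_scope.
Local Open Scope ring_scope.

(** The algebra of the conclusion is short: with [y = J_B w] and
    [z = J_A (2 y - w)] one has [T w = w + 2 (z - y)], so a step of length
    [lambda] along [z - y] is a Mann step of length [lambda / 2] along [T]
    ([A] and [B] stand for their multiples by [gamma]).
    Nonexpansiveness of [T] comes from monotonicity, applied to
    [J_A x] and [J_A y], which gives
    [|R_A x - R_A y|^2 = |x - y|^2 - 4 <J_A x - J_A y, (x - J_A x) - (y - J_A y)>].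
    A zero [c] of [A + B], with [b] in [B c] and [- b] in [A c], yields the fixed
    point [c + b], since [R_B] sends it to [c - b] and [R_A] sends that back.

    The substance is that [J_A x] really is a point of the resolvent, that is,
    Minty's theorem ([minty]).  After a translation one must find [x] with
    [- x] in [A x].  For a maximally monotone [A] consider on [H * H]
      [f (x, v) = sup over b in A a of |x + v|^2 - 2 <x - a, v - b>],
    which is the Fitzpatrick function of [A] doubled and increased by
    [|x|^2 + |v|^2].
    - Each term of the supremum also equals [|x + b|^2 + |v + a|^2 - |a + b|^2]
      ([envelope_ballE]), so [f] is strongly convex and lower semicontinuous, and
      completeness makes it attain its infimum [e] at some [(x, v)]
      ([envelope_min]); moreover, [e + |(x, v) - q|^2 <= f q] for all [q]
      ([envelope_min_gap]).
    - Maximality gives [|x + v|^2 <= f (x, v)] ([envelope_ge]), and monotonicity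
      gives [f (a, b) <= |a + b|^2] on the graph of [A] ([envelope_graph]).
    Taking [q = (a, b)] in the graph and combining these bounds yields
      [2 <- v - a, - x - b> >= e + |x + v|^2 >= 0],
    so [- x] belongs to [A (- v)] by maximality; taking then [a = - v] and
    [b = - x] yields [x + v = 0]. *)

(** * Real inner products and completeness *)

Section InnerProduct.
Context {R : realType} {H : hilbertType R}.
Implicit Types (x y z : H) (a t : R).

Lemma innerC x y : inner x y = inner y x.
Proof. by have := hermC (@inner R H) x y; rewrite expr0 mul1r. Qed.

Lemma innerDl x y z : inner (x + y) z = inner x z + inner y z.
Proof. exact: linearDl. Qed.

Lemma innerDr x y z : inner z (x + y) = inner z x + inner z y.
Proof. exact: linearDr. Qed.

Lemma innerNl x z : inner (- x) z = - inner x z.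
Proof. exact: linearNl. Qed.

Lemma innerNr x z : inner z (- x) = - inner z x.
Proof. exact: linearNr. Qed.

Lemma innerZl a x z : inner (a *: x) z = a * inner x z.
Proof. exact: linearZl_LR. Qed.

Lemma innerZr a x z : inner z (a *: x) = a * inner z x.
Proof. exact: linearZr_LR. Qed.

Definition innerE := (innerDl, innerDr, innerNl, innerNr, innerZl, innerZr).

(** The defect [t (1 - t) |x - y|^2] does not depend on [z]: this is what makes a
    supremum of such squared norms strongly convex. *)
Lemma sqr_norm_convex t x y z :
  `|(1 - t) *: x + t *: y + z| ^+ 2 =
  (1 - t) * `|x + z| ^+ 2 + t * `|y + z| ^+ 2 - t * (1 - t) * `|x - y| ^+ 2.
Proof.
rewrite !norm_inner !innerE (innerC y x) (innerC z x) (innerC z y); ring.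
Qed.

Lemma cvgn_of_sqr_dist (x : nat -> H) (e : nat -> R) :
  e n @[n --> \oo] --> (0 : R) ->
  (forall n k, `|x n - x k| ^+ 2 <= e n + e k) -> cvgn x.
Proof.
move=> e0 hd; apply: cauchy_cvg; apply: cauchy_exP => d d0.
have [N _ hN] : \forall n \near \oo, e n < d ^+ 2 / 2.
  by apply: (cvgr_lt _ e0); rewrite divr_gt0 // exprn_gt0.
exists (x N); exists N => // n /= Nn; rewrite -ball_normE /=.
rewrite -(ltr_pXn2r (n := 2)) ?nnegrE ?(ltW d0)//.
apply: le_lt_trans (hd N n) _; rewrite (splitr (d ^+ 2)).
by apply: ltrD; apply: hN => /=.
Qed.

End InnerProduct.

(** * Minty's theorem *)

Section Minty.
Context {R : realType} {H : hilbertType R}.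
Implicit Types (A B : H -> set H) (x y v w a b : H) (e s t g : R).

(** A pair monotonically related to the whole graph can be added to it without
    losing monotonicity, so a maximal graph already contains it. *)
Lemma maximally_monotoneP A :
  maximally_monotone A <->
  Defs.monotone A /\
  forall x v, (forall a b, A a b -> 0 <= inner (x - a) (v - b)) -> A x v.
Proof.
split=> -[mA hA]; split => //.
  move=> x v xv; apply: contrapT => nA; apply: hA.
  exists (fun a => [set b | A a b \/ (a = x /\ b = v)]); split.
    move=> a a' b b' /= [h|[-> ->]] [h'|[-> ->]].
    - exact: mA.
    - by have := xv _ _ h; rewrite -opprB -(opprB b) innerNl innerNr opprK.
    - exact: xv.
    - by rewrite subrr linear0l.
  split; first by move=> [a b] /= h; left.
  by move=> /(_ (x, v)) /= h; apply: nA; apply: h; right.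
move=> [B [mB [AB BA]]]; apply: BA => -[x v] /= Bxv; apply: hA => a b Aab.
by apply: mB => //; exact: (AB (a, b)).
Qed.

(** The epigraph of the function [f] of the introduction: [f (x, v) <= e].  The
    relational form avoids a supremum that may be infinite. *)
Definition envelope A e x v : Prop :=
  forall a b, A a b -> `|x + v| ^+ 2 - 2 * inner (x - a) (v - b) <= e.

(** Each constraint confines [(x, v)] to a ball of [H * H] centred at [(- b, - a)];
    convexity and closedness are read off from this form. *)
Lemma envelope_ballE A e x v :
  envelope A e x v <->
  forall a b, A a b -> `|x + b| ^+ 2 + `|v + a| ^+ 2 <= e + `|a + b| ^+ 2.
Proof.
suff E a b : `|x + b| ^+ 2 + `|v + a| ^+ 2 - `|a + b| ^+ 2 =
    `|x + v| ^+ 2 - 2 * inner (x - a) (v - b).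
  by split=> h a b /h; have := E a b; lra.
rewrite !norm_inner !innerE (innerC v x) (innerC b x) (innerC a v) (innerC b a).
ring.
Qed.

Lemma envelope_graph A a b : Defs.monotone A -> A a b ->
  envelope A (`|a + b| ^+ 2) a b.
Proof. by move=> mA Aab a' b' /(mA _ _ _ _ Aab); lra. Qed.

(** If the bound failed, all products [<x - a, v - b>] would be positive, so [(x, v)]
    would be in the graph by maximality, where the constraint of the pair [(x, v)]
    itself gives the bound. *)
Lemma envelope_ge A e x v : maximally_monotone A ->
  envelope A e x v -> `|x + v| ^+ 2 <= e.
Proof.
move=> /maximally_monotoneP[mA hA] hE.
have [Axv|nAxv] := pselect (A x v).
  by have := hE _ _ Axv; rewrite subrr linear0l mulr0 subr0.
rewrite leNgt; apply/negP => lt_e; apply: nAxv; apply: hA => a b /hE; lra.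
Qed.

Lemma envelope_convex A e s t x v y w : 0 <= t <= 1 ->
  envelope A e x v -> envelope A s y w ->
  envelope A ((1 - t) * e + t * s
              - t * (1 - t) * (`|x - y| ^+ 2 + `|v - w| ^+ 2))
    ((1 - t) *: x + t *: y) ((1 - t) *: v + t *: w).
Proof.
move=> /andP[t0 t1] /envelope_ballE he /envelope_ballE hs.
apply/envelope_ballE => a b Aab; rewrite !sqr_norm_convex.
have /(ler_wpM2l t0) := hs _ _ Aab.
have /(ler_wpM2l (_ : 0 <= 1 - t)) := he _ _ Aab.
rewrite subr_ge0 => /(_ t1); lra.
Qed.

Lemma envelope_cvg A (e : nat -> R) (x v : nat -> H) s y w :
  (forall n, envelope A (e n) (x n) (v n)) ->
  e n @[n --> \oo] --> s -> x n @[n --> \oo] --> y -> v n @[n --> \oo] --> w ->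
  envelope A s y w.
Proof.
move=> hE es xy vw; apply/envelope_ballE => a b Aab.
have sq (z : nat -> H) (l c : H) : z n @[n --> \oo] --> l ->
    `|z n + c| ^+ 2 @[n --> \oo] --> `|l + c| ^+ 2.
  move=> zl; rewrite expr2; under eq_cvg do rewrite expr2.
  have h : `|z n + c| @[n --> \oo] --> `|l + c|.
    by apply: cvg_norm; apply: cvgD => //; exact: cvg_cst.
  exact: cvgM.
have hl : `|x n + b| ^+ 2 + `|v n + a| ^+ 2 @[n --> \oo] -->
    `|y + b| ^+ 2 + `|w + a| ^+ 2 by apply: cvgD; exact: sq.
have hr : e n + `|a + b| ^+ 2 @[n --> \oo] --> s + `|a + b| ^+ 2.
  by apply: cvgD => //; exact: cvg_cst.
apply: (ler_cvg_to hl hr); near=> n.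
by have /envelope_ballE := hE n; apply.
Unshelve. all: by end_near.
Qed.

(** At a midpoint [f] lies below the average of the two values by at least a quarter
    of the squared distance, so minimising sequences are Cauchy. *)
Lemma envelope_min A : maximally_monotone A ->
  exists e x v, envelope A e x v /\
    forall s y w, envelope A s y w -> e <= s.
Proof.
move=> maxA; have /maximally_monotoneP[mA hA] := maxA.
pose E := [set e | exists x v, envelope A e x v].
have E_inf : has_inf E.
  split; last first.
    by exists 0 => e [x [v /(envelope_ge maxA)]]; apply: le_trans; exact: sqr_ge0.
  (* the empty graph is not maximal: every pair is vacuously related to it *)
  apply: contrapT => nE; have noA a b : ~ A a b.
    by move=> Aab; apply: nE; exists (`|a + b| ^+ 2), a, b; exact: envelope_graph.
  by apply: (noA 0 0); apply: hA => a b /noA.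
have inf_le e x v : envelope A e x v -> inf E <= e.
  by move=> h; apply: ge_inf; [exact: E_inf.2 | exists x, v].
have /choice[p hp] n : exists p : H * H * R,
    envelope A p.2 p.1.1 p.1.2 /\ p.2 < inf E + n.+1%:R^-1.
  have [|e [x [v h]] lt_e] := @inf_adherent R E (n.+1%:R^-1) _ E_inf.
    by rewrite invr_gt0.
  by exists (x, v, e).
have close n k : `|(p n).1.1 - (p k).1.1| ^+ 2 + `|(p n).1.2 - (p k).1.2| ^+ 2
    <= 2 * n.+1%:R^-1 + 2 * k.+1%:R^-1.
  have [[hn en] [hk ek]] := (hp n, hp k).
  have half : 0 <= (2^-1 : R) <= 1 by lra.
  have := inf_le _ _ _ (envelope_convex half hn hk).
  move: en ek; move: (n.+1%:R^-1) (k.+1%:R^-1) (inf E) => i j m; lra.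
have eps0 : 2 * n.+1%:R^-1 @[n --> \oo] --> (0 : R).
  by rewrite -[0](mulr0 2); apply: cvgMr; exact: cvg_harmonic.
have cx : cvgn (fun n => (p n).1.1).
  apply: (cvgn_of_sqr_dist eps0) => n k; apply: le_trans (close n k).
  by rewrite lerDl sqr_ge0.
have cv : cvgn (fun n => (p n).1.2).
  apply: (cvgn_of_sqr_dist eps0) => n k; apply: le_trans (close n k).
  by rewrite lerDr sqr_ge0.
exists (inf E), (lim ((p n).1.1 @[n --> \oo])), (lim ((p n).1.2 @[n --> \oo])).
split; last by move=> s y w; exact: inf_le.
apply: (envelope_cvg (e := fun n => (p n).2) _ _ cx cv) => [n|].
  by have [] := hp n.
apply: (squeeze_cvgr (f := fun=> inf E) (h := fun n => inf E + n.+1%:R^-1)).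
- near=> n; have [hn en] := hp n; rewrite (ltW en) andbT; exact: inf_le hn.
- exact: cvg_cst.
- rewrite -[X in _ --> X]addr0; apply: cvgD; [exact: cvg_cst|exact: cvg_harmonic].
Unshelve. all: by end_near.
Qed.

(** Moving from the minimiser towards [(y, w)] by a fraction [t] gives
    [e + (1 - t) D <= s], where [D] is the squared distance; then [t] tends to 0. *)
Lemma envelope_min_gap A e x v : envelope A e x v ->
  (forall s y w, envelope A s y w -> e <= s) ->
  forall s y w, envelope A s y w ->
  e + (`|x - y| ^+ 2 + `|v - w| ^+ 2) <= s.
Proof.
move=> he emin s y w hs; set D := _ + `|v - w| ^+ 2.
apply/ler_addgt0Pr => d d0.
have D0 : 0 <= D by rewrite addr_ge0 ?sqr_ge0.
have [dD|Dd] := leP d D; last by have := emin _ _ _ hs; lra.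
(* this [t] makes the loss [t * D] at most [d] *)
pose t := d / (D + d).
have Dd0 : 0 < D + d by lra.
have t0 : 0 < t by rewrite divr_gt0.
have t1 : t <= 1 by rewrite ler_pdivrMr// mul1r; lra.
have tD : t * D <= d.
  by rewrite mulrAC ler_pdivrMr// ler_pM2l//; lra.
have t01 : 0 <= t <= 1 by rewrite (ltW t0).
have := emin _ _ _ (envelope_convex t01 he hs); rewrite -/D => h.
have : 0 <= t * (s - e - (1 - t) * D) by lra.
by rewrite pmulr_rge0//; lra.
Qed.

(** The minimiser [(x, v)] of the envelope satisfies [v = - x], and the pair with
    opposite components [(- v, - x)] lies in the graph. *)
Lemma minty_zero A : maximally_monotone A -> exists x, A x (- x).
Proof.
move=> maxA; have /maximally_monotoneP[mA hA] := maxA.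
have [e [x [v [he emin]]]] := envelope_min maxA.
have xv_e := envelope_ge maxA he.
have related a b : A a b ->
    e + `|x + v| ^+ 2 <= 2 * inner (- v - a) (- x - b).
  move=> Aab; have := envelope_min_gap he emin (envelope_graph mA Aab).
  rewrite !norm_inner !innerE.
  rewrite (innerC b a) (innerC a x) (innerC v x) (innerC b v); lra.
have Avx : A (- v) (- x).
  by apply: hA => a b /related; have := sqr_ge0 `|x + v|; lra.
exists (- v); suff : x + v = 0.
  by move=> /eqP; rewrite addr_eq0 => /eqP x_eq; move: Avx; rewrite x_eq.
apply/eqP; rewrite -normr_eq0 -sqrf_eq0 eq_le sqr_ge0 andbT.
by have := related _ _ Avx; rewrite subrr linear0l mulr0; lra.
Qed.

(** An affine change of the values multiplies the products [<x - y, v - w>] by a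
    positive constant.  It covers both the positive multiples of [A] and the
    translation that brings an arbitrary point of the range of [Id + A] to 0. *)
Lemma maximally_monotone_affine A g w : 0 < g -> maximally_monotone A ->
  maximally_monotone (fun x => [set v | A x (g *: v + w)]).
Proof.
move=> g0 /maximally_monotoneP[mA hA]; apply/maximally_monotoneP.
have E x y v v' : inner (x - y) ((g *: v + w) - (g *: v' + w)) =
    g * inner (x - y) (v - v').
  by rewrite opprD addrACA subrr addr0 -scalerBr innerZr.
split=> [x y v v' /= Ax Ay|x v hxv /=].
  by have := mA _ _ _ _ Ax Ay; rewrite E pmulr_rge0.
apply: hA => a b Aab.
have gK : b = g *: (g^-1 *: (b - w)) + w.
  by rewrite scalerA mulfV ?gt_eqF// scale1r subrK.
by rewrite gK E pmulr_rge0//; apply: hxv; rewrite /= -gK.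
Qed.

Lemma op_scaleE A g : g != 0 ->
  op_scale g A = fun x => [set v | A x (g^-1 *: v)].
Proof.
move=> g0; apply/funext => x; apply/seteqP; split=> v /=.
  by move=> [v' Av' <-]; rewrite scalerA mulVf// scale1r.
by exists (g^-1 *: v) => //; rewrite scalerA mulfV// scale1r.
Qed.

Lemma maximally_monotone_scale A g : 0 < g -> maximally_monotone A ->
  maximally_monotone (op_scale g A).
Proof.
move=> g0 maxA; rewrite op_scaleE ?gt_eqF//.
under eq_fun do under eq_set do rewrite -[_ *: _]addr0.
by apply: maximally_monotone_affine; rewrite ?invr_gt0.
Qed.

Lemma set_resolventE A x y : set_resolvent A x y <-> A y (x - y).
Proof.
split=> [[_ [v [-> Av ->]]]|Ay]; first by rewrite addrC addKr.
by exists y, (x - y); split => //; rewrite addrC subrK.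
Qed.

Lemma minty A x : maximally_monotone A -> A (resolvent A x) (x - resolvent A x).
Proof.
move=> maxA; apply/set_resolventE; apply: xgetPex.
have [y Ay] := minty_zero (maximally_monotone_affine x ltr01 maxA).
by exists y; apply/set_resolventE; move: Ay => /=; rewrite scale1r addrC.
Qed.

Lemma resolvent_eq A x y : Defs.monotone A -> A y (x - y) -> resolvent A x = y.
Proof.
move=> mA Ay; have /set_resolventE Ar : set_resolvent A x (resolvent A x).
  by apply: xgetPex; exists y; exact/set_resolventE.
apply/eqP; rewrite -subr_eq0 -normr_eq0 -sqrf_eq0 eq_le sqr_ge0 andbT.
have := mA _ _ _ _ Ar Ay.
rewrite norm_inner !innerE (innerC (resolvent A x)); lra.
Qed.

(** * Reflected resolvents and the Douglas-Rachford operator *)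

Lemma reflected_resolvent_nonexpansive A : maximally_monotone A ->
  nonexpansive (reflected_resolvent A).
Proof.
move=> maxA x y; have [mA _] := maxA.
have := mA _ _ _ _ (minty x maxA) (minty y maxA).
rewrite /reflected_resolvent; set p := resolvent A x; set q := resolvent A y.
move=> pq; rewrite -(ler_pXn2r (n := 2)) ?nnegrE//.
have -> : `|2 *: p - x - (2 *: q - y)| ^+ 2 =
    `|x - y| ^+ 2 - 4 * inner (p - q) (x - p - (y - q)).
  rewrite !norm_inner !innerE.
  rewrite (innerC q p) (innerC y x) (innerC x p) (innerC x q) (innerC y p).
  rewrite (innerC y q); ring.
by rewrite gerDl oppr_le0 mulr_ge0.
Qed.

Lemma douglas_rachford_fixed_point A B x :
  Defs.monotone A -> Defs.monotone B -> zer (op_add A B) x ->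
  exists w, (reflected_resolvent A \o reflected_resolvent B) w = w.
Proof.
move=> mA mB [a [b [Aa Bb /esym/eqP]]]; rewrite addr_eq0 => /eqP ab.
subst a; exists (x + b).
have RB : reflected_resolvent B (x + b) = x - b.
  rewrite /reflected_resolvent (resolvent_eq (y := x))//.
    by rewrite scaler_nat mulr2n opprD addrACA subrr add0r.
  by rewrite addrC addKr.
rewrite /= RB /reflected_resolvent (resolvent_eq (y := x))//.
  by rewrite scaler_nat mulr2n opprB addrACA subrr addr0.
by rewrite addrC addKr.
Qed.

Lemma zer_op_scale A B g x : zer (op_add A B) x ->
  zer (op_add (op_scale g A) (op_scale g B)) x.
Proof.
move=> [a [b [Aa Bb ab]]]; exists (g *: a), (g *: b).
by split; [exists a|exists b|rewrite -scalerDr -ab scaler0].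
Qed.

End Minty.

Theorem mainTheorem4 (R : realType) (H : hilbertType R)
    (A B : H -> set H)
    (hA : maximally_monotone A) (hB : maximally_monotone B)
    (hzer : zer (op_add A B) !=set0)
    (gamma : R) (hgamma : 0 < gamma)
    (x0 u : H) (lambda beta : nat -> R)
    (hlambda : forall n, 0 <= lambda n <= 2)
    (hbeta : forall n, 0 <= beta n <= 1)
    (x us y z : nat -> H)
    (hx0 : x 0%N = x0)
    (hu : forall n, us n = (1 - beta n) *: u + beta n *: x n)
    (hy : forall n, y n = resolvent (op_scale gamma B) (us n))
    (hz : forall n, z n = resolvent (op_scale gamma A) (2 *: y n - us n))
    (hx : forall n, x n.+1 = us n + lambda n *: (z n - y n)) :
  let T := reflected_resolvent (op_scale gamma A)
             \o reflected_resolvent (op_scale gamma B) in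
  [/\ nonexpansive T,
      Fix T !=set0,
      forall n, x n.+1 = (1 - lambda n / 2) *: us n + (lambda n / 2) *: T (us n)
    & is_tikhonov_mann T x0 u beta (fun n => lambda n / 2) x].
Proof.
move=> T.
have maxA := maximally_monotone_scale hgamma hA.
have maxB := maximally_monotone_scale hgamma hB.
have T_ne : nonexpansive T.
  move=> a b; apply: le_trans (reflected_resolvent_nonexpansive maxB a b).
  exact: reflected_resolvent_nonexpansive.
have T_fix : Fix T !=set0.
  have [c /(zer_op_scale gamma)] := hzer.
  by apply: douglas_rachford_fixed_point; [case: maxA|case: maxB].
have T_us n : T (us n) = us n + 2 *: (z n - y n).
  rewrite /T /= /reflected_resolvent -hy -hz.
  by rewrite opprB addrCA scalerBr.
have step n : x n.+1 =
    (1 - lambda n / 2) *: us n + (lambda n / 2) *: T (us n).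
  rewrite hx T_us [X in _ = _ + X]scalerDr addrA -scalerDl subrK scale1r scalerA.
  by rewrite divfK// pnatr_eq0.
split=> //; split=> // n; last by rewrite /= -hu; exact: step.
by have := hlambda n; lra.
Qed.
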